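(* Let $\mathfrak{A}$ be a residuated lattice with underlying set $A$ and let $\Pi$ be a collection of prime filters of $\mathfrak{A}$. For $X\subseteq A$ let $h(X)=\{P\in\Pi\mid X\subseteq P\}$ and for $\mathcal{F}\subseteq\Pi$ let $k(\mathcal{F})=\bigcap\mathcal{F}$. Then $hk:\mathcal{P}(\Pi)\to\mathcal{P}(\Pi)$, $\mathcal{F}\mapsto h(k(\mathcal{F}))$, is a topological closure operator on $\Pi$.
   Context: A residuated lattice is an algebra $\mathfrak{A}=(A;\vee,\wedge,\odot,\rightarrow,0,1)$ such that $(A;\vee,\wedge,0,1)$ is a bounded lattice, $(A;\odot,1)$ is a commutative monoid, and $(\odot,\rightarrow)$ is an adjoint pair, i.e. $x\odot y\le z$ iff $x\le y\rightarrow z$. A filter of $\mathfrak{A}$ is a non-empty subset $F\subseteq A$ such that $x,y\in F$ implies $x\odot y\in F$, and $x\in F$, $y\in A$ imply $x\vee y\in F$. A filter is proper if it is not equal to $A$. A proper filter $P$ is prime if for all filters $F_1,F_2$, $F_1\cap F_2=P$ implies $F_1=P$ or $F_2=P$. The intersection of the empty family of filters is taken to be $A$. A closure operator on the set $\Pi$ is an inflationary, monotone, idempotent map $\mathcal{P}(\Pi)\to\mathcal{P}(\Pi)$; it is called topological if it preserves finite unions and the empty set. *)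

(* Defs.v *)
From HB Require Import structures.
From mathcomp Require Import all_boot all_order all_classical.

Set Implicit Arguments.
Unset Strict Implicit.
Unset Printing Implicit Defensive.

Import Order.TTheory.

Local Open Scope order_scope.
Local Open Scope classical_set_scope.

(* In a MathComp bounded lattice, 0 is \bot and 1 is \top; the degenerate case
   \bot = \top is allowed. *)
HB.mixin Record TBLattice_isResiduated d T of Order.TBLattice d T := {
  rl_mul : T -> T -> T;
  rl_imp : T -> T -> T;
  rl_mulA : associative rl_mul;
  rl_mulC : commutative rl_mul;
  rl_mul1x : left_id \top rl_mul;
  rl_adjoint : forall x y z : T, (rl_mul x y <= z) = (x <= rl_imp y z)
}.

#[short(type="residuatedLatticeType")]
HB.structure Definition ResiduatedLattice d :=
  { T of Order.TBLattice d T & TBLattice_isResiduated d T }.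

Section Filters.
Context {d : Order.disp_t} {A : residuatedLatticeType d}.
Implicit Types F P X : set A.

Definition rl_filter F : Prop :=
  [/\ F !=set0,
      forall x y, F x -> F y -> F (rl_mul x y)
    & forall x y, F x -> F (x `|` y)%O].

Definition rl_proper_filter F : Prop := rl_filter F /\ F <> setT.

Definition rl_prime_filter P : Prop :=
  rl_proper_filter P /\
  forall F1 F2, rl_filter F1 -> rl_filter F2 ->
    F1 `&` F2 = P -> F1 = P \/ F2 = P.

Definition hull (Pi : set (set A)) X : set (set A) :=
  [set P | Pi P /\ X `<=` P].

(* The empty intersection is setT, that is, A. *)
Definition kernel (FF : set (set A)) : set A := \bigcap_(P in FF) P.

End Filters.

Section ClosureOperators.
Context {T : Type}.
Implicit Types (Pi F G : set T) (c : set T -> set T).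

(* A map from the powerset of Pi to itself is represented by a map c on all
   sets, of which only the values at subsets of Pi matter. *)
Definition closure_operator Pi c : Prop :=
  [/\ forall F, F `<=` Pi -> c F `<=` Pi,
      forall F, F `<=` Pi -> F `<=` c F,
      forall F G, F `<=` Pi -> G `<=` Pi -> F `<=` G -> c F `<=` c G
    & forall F, F `<=` Pi -> c (c F) = c F].

Definition topological_closure_operator Pi c : Prop :=
  [/\ closure_operator Pi c,
      forall C : set (set T), finite_set C -> (forall F, C F -> F `<=` Pi) ->
        c (\bigcup_(F in C) F) = \bigcup_(F in C) c F
    & c set0 = set0].

End ClosureOperators.

(* Main.v *)
(* The filters of a residuated lattice form a distributive lattice, so a prime
   filter containing F1 `&` F2 contains F1 or F2.  Applied to the kernels of two
   families this gives the preservation of binary unions by hk. *)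
Require Import Defs.
From mathcomp Require Import all_boot all_order all_classical.

Local Open Scope classical_set_scope.

Section ResiduatedLatticeTheory.
Context {d : Order.disp_t} {A : residuatedLatticeType d}.
Implicit Types (x y z : A) (F P : set A).
Import Order.TTheory.
Local Open Scope order_scope.
Local Open Scope classical_set_scope.

Lemma rl_le_mul x y z t : x <= y -> z <= t -> rl_mul x z <= rl_mul y t.
Proof.
have mull (u v w : A) : u <= v -> rl_mul u w <= rl_mul v w.
  by move=> uv; rewrite rl_adjoint (le_trans uv)// -rl_adjoint.
move=> xy zt; apply: le_trans (mull _ _ z xy) _.
by rewrite rl_mulC [leRHS]rl_mulC; apply: mull.
Qed.

(** Multiplication by [z] is a lower adjoint, so it respects joins; this is the source of
    distributivity in the lattice of filters. *)
Lemma rl_mul_joinl_le x y z t :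
  rl_mul x z <= t -> rl_mul y z <= t -> rl_mul (x `|` y)%O z <= t.
Proof. by rewrite !rl_adjoint leUx => -> ->. Qed.

Lemma rl_mulx1 x : rl_mul x \top = x.
Proof. by rewrite rl_mulC rl_mul1x. Qed.

Lemma rl_mul_lel x y : rl_mul x y <= x.
Proof. by rewrite -[leRHS]rl_mulx1 rl_le_mul// lex1. Qed.

Lemma rl_mul_ler x y : rl_mul x y <= y.
Proof. by rewrite rl_mulC rl_mul_lel. Qed.

Lemma rl_filter_up {F x y} : rl_filter F -> x <= y -> F x -> F y.
Proof. by case=> _ _ FU /join_r <- Fx; apply: FU. Qed.

Lemma rl_filter1 {F} : rl_filter F -> F \top.
Proof.
by move=> Ff; have [[x Fx] _ _] := Ff; apply: (rl_filter_up Ff (lex1 x) Fx).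
Qed.

Lemma kernel_filter (FF : set (set A)) :
  (forall F, FF F -> rl_filter F) -> rl_filter (kernel FF).
Proof.
move=> FFf; split.
- by exists \top => F /FFf /rl_filter1.
- by move=> x y kx ky F FF_F; have [_ + _] := FFf _ FF_F; apply; [apply: kx|apply: ky].
- by move=> x y kx F FF_F; have [_ _] := FFf _ FF_F; apply; apply: kx.
Qed.

(** For filters [F] and [P] this is the filter generated by their union, that is, their join in the
    lattice of filters. *)
Definition filter_join F P : set A :=
  [set z | exists x y, [/\ F x, P y & rl_mul x y <= z]].

Lemma filter_join_filter F P :
  rl_filter F -> rl_filter P -> rl_filter (filter_join F P).
Proof.
move=> Ff Pf; have [_ FM _] := Ff; have [_ PM _] := Pf; split.
- exists \top, \top, \top.
  by split; [exact: rl_filter1|exact: rl_filter1|exact: lex1].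
- move=> z t [x [y [Fx Py xyz]]] [u [v [Fu Pv uvt]]].
  exists (rl_mul x u), (rl_mul y v); split; [exact: FM|exact: PM|].
  suff -> : rl_mul (rl_mul x u) (rl_mul y v) = rl_mul (rl_mul x y) (rl_mul u v).
    exact: rl_le_mul.
  by rewrite -!rl_mulA (rl_mulA u) (rl_mulC u y) -rl_mulA.
- move=> z t [x [y [Fx Py xyz]]]; exists x, y; split=> //.
  exact: le_trans xyz (leUl _ _).
Qed.

Lemma sub_filter_joinl F P : rl_filter P -> F `<=` filter_join F P.
Proof.
move=> Pf x Fx; exists x, \top; split=> //; first exact: rl_filter1.
by rewrite rl_mulx1.
Qed.

Lemma sub_filter_joinr F P : rl_filter F -> P `<=` filter_join F P.
Proof.
move=> Ff x Px; exists \top, x; split=> //; first exact: rl_filter1.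
by rewrite rl_mul1x.
Qed.

(** An instance of distributivity: the meet of the two joins is the join of [F1]&[F2] with [P],
    which [P] absorbs. *)
Lemma filter_join_setI F1 F2 P :
  rl_filter F1 -> rl_filter F2 -> rl_filter P -> F1 `&` F2 `<=` P ->
  filter_join F1 P `&` filter_join F2 P = P.
Proof.
move=> F1f F2f Pf F12P; apply/seteqP; split; last first.
  by move=> x Px; split; apply: sub_filter_joinr.
move=> z [[x [y [F1x Py xyz]]] [u [v [F2u Pv uvz]]]].
have [_ PM _] := Pf.
(* The element [x]|[u] lies above both [x] and [u], hence in both filters. Its product with
   [rl_mul y v] will be the element of [P] below [z]. *)
have Pxu : P (x `|` u)%O.
  apply: F12P; split.
    exact: (rl_filter_up F1f (leUl _ _) F1x).
  exact: (rl_filter_up F2f (leUr _ _) F2u).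
apply: (rl_filter_up Pf _ (PM _ _ Pxu (PM _ _ Py Pv))).
(* Dropping one factor gives x(yv) <= xy <= z and u(yv) <= uv <= z. *)
by apply: rl_mul_joinl_le;
  [apply: le_trans xyz|apply: le_trans uvz];
  rewrite rl_le_mul// ?rl_mul_lel ?rl_mul_ler.
Qed.

(** Primeness speaks only of filters that meet exactly in [P], so it is applied to the joins of [F1]
    and [F2] with [P]. A join equal to [P] forces its first argument into [P]. *)
Lemma prime_filter_setI P F1 F2 : rl_prime_filter P ->
  rl_filter F1 -> rl_filter F2 -> F1 `&` F2 `<=` P -> F1 `<=` P \/ F2 `<=` P.
Proof.
move=> [[Pf _] Pprime] F1f F2f F12P.
have [] := Pprime _ _ (filter_join_filter _ _ F1f Pf)
  (filter_join_filter _ _ F2f Pf) (filter_join_setI _ _ _ F1f F2f Pf F12P) => <-.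
- by left; apply: sub_filter_joinl.
- by right; apply: sub_filter_joinl.
Qed.

End ResiduatedLatticeTheory.

Section HullKernel.
Context {d : Order.disp_t} {A : residuatedLatticeType d}.
Context {Pi : set (set A)}.
Implicit Types F G : set (set A).

Lemma hull_anti (X Y : set A) : X `<=` Y -> hull Pi Y `<=` hull Pi X.
Proof. by move=> XY P [PiP YP]; split=> //; apply: subset_trans YP. Qed.

Lemma kernel_anti F G : F `<=` G -> kernel G `<=` kernel F.
Proof. by move=> FG x kx P /FG; apply: kx. Qed.

Lemma sub_hull_kernel F : F `<=` Pi -> F `<=` hull Pi (kernel F).
Proof. by move=> FPi P FP; split; [exact: FPi|move=> x; apply]. Qed.

Lemma kernel_hull (X : set A) : X `<=` kernel (hull Pi X).
Proof. by move=> x Xx P [_]; apply. Qed.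

(** [hull Pi] and [kernel] form an antitone Galois connection, so this part holds for any family
    [Pi] of subsets. *)
Lemma hull_kernel_closure :
  closure_operator Pi (fun F => hull Pi (kernel F)).
Proof.
split=> [F _ P []//|F|F G _ _ FG|F FPi].
- exact: sub_hull_kernel.
- exact: hull_anti (kernel_anti _ _ FG).
- apply/seteqP; split; first exact: hull_anti (kernel_hull _).
  by apply: sub_hull_kernel => P [].
Qed.

Hypothesis Pi_prime : forall P, Pi P -> rl_prime_filter P.

(** The empty intersection is all of [A], which no proper filter contains. *)
Lemma hull_kernel_set0 : hull Pi (kernel set0) = set0.
Proof.
rewrite /kernel bigcap_set0 -subset0 => P [/Pi_prime[[_ PT] _] TP].
by apply: PT; apply/seteqP; split.
Qed.

Lemma hull_kernel_setU F G : F `<=` Pi -> G `<=` Pi ->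
  hull Pi (kernel (F `|` G)) = hull Pi (kernel F) `|` hull Pi (kernel G).
Proof.
move=> FPi GPi; apply/seteqP; split; last first.
  by rewrite subUset; split; apply: hull_anti; apply: kernel_anti => P; [left|right].
have kf H : H `<=` Pi -> rl_filter (kernel H).
  by move=> HPi; apply: kernel_filter => P /HPi /Pi_prime[[]].
(* The kernel of a union is the intersection of the kernels, so primeness of [P] puts one of them
   inside [P]. *)
move=> P [PiP]; rewrite /kernel bigcap_setU => kP.
have [kFP|kGP] :=
  prime_filter_setI _ _ _ (Pi_prime _ PiP) (kf _ FPi) (kf _ GPi) kP.
- by left.
- by right.
Qed.

End HullKernel.

(** Induction on a list enumerating [C]: [c set0 = set0] settles the empty family, and the binary
    case adds one member. *)
Lemma preserves_finite_unions (T : Type) (Pi : set T) (c : set T -> set T) :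
  c set0 = set0 ->
  (forall F G, F `<=` Pi -> G `<=` Pi -> c (F `|` G) = c F `|` c G) ->
  forall C : set (set T), finite_set C -> (forall F, C F -> F `<=` Pi) ->
    c (\bigcup_(F in C) F) = \bigcup_(F in C) c F.
Proof.
move=> c0 cU C /finite_seqP[s ->]; elim: s => [|F s IHs] sPi.
  by rewrite set_nil !bigcup_set0.
have sPi' G : G \in s -> G `<=` Pi.
  by move=> Gs; apply: sPi; rewrite /= inE Gs orbT.
have -> : [set` F :: s] = F |` [set` s].
  by apply/seteqP; split=> G; rewrite /= inE => /predU1P.
rewrite !bigcup_setU1 cU ?IHs//; first by apply: sPi; rewrite /= mem_head.
exact: bigcup_sub.
Qed.

Theorem theorem3p8 (d : Order.disp_t) (A : residuatedLatticeType d)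
    (Pi : set (set A)) (hPi : forall P : set A, Pi P -> rl_prime_filter P) :
  topological_closure_operator Pi (fun F : set (set A) => hull Pi (kernel F)).
Proof.
split; first exact: hull_kernel_closure.
- apply: preserves_finite_unions; first exact: hull_kernel_set0.
  exact: hull_kernel_setU.
- exact: hull_kernel_set0.
Qed.
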